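(* Let $N=\{1,\dots,n\}$ and let $\mathcal{D}_1,\dots,\mathcal{D}_n$ be any nonatomic probability distributions on $[0,1]$. Then there exists a set of equalizing multipliers, i.e. a vector $\vec\beta\in\mathbb{R}_{>0}^n$ such that $p_i(\vec\beta)=1/n$ for every $i\in N$.
   Context: For $\vec\beta\in\mathbb{R}_{>0}^n$ and $i\in N$, the resulting probability of agent $i$ is $p_i(\vec\beta)=\mathbb{P}\left[\beta_i u_i=\max_{j\in N}\beta_j u_j\right]$, where $u_1,\dots,u_n$ are independent random variables with $u_j\sim\mathcal{D}_j$. Multipliers $\vec\beta$ are called equalizing if all resulting probabilities equal $1/n$. *)

(* Defs.v *)
From HB Require Import structures.
From mathcomp Require Import all_boot all_order all_algebra.
From mathcomp Require Import all_classical all_reals all_analysis.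
Set Implicit Arguments.
Unset Strict Implicit.
Unset Printing Implicit Defensive.
Import Order.TTheory GRing.Theory Num.Theory.
Import numFieldNormedType.Exports.
Local Open Scope classical_set_scope.
Local Open Scope ring_scope.

(* On the real line, being free of atoms amounts to giving mass 0 to points. *)
Definition nonatomic (R : realType)
    (mu : {measure set (measurableTypeR R) -> \bar R}) : Prop :=
  forall x : R, mu [set x] = 0%E.

Definition mutually_independent (d : measure_display) (Omega : measurableType d)
    (R : realType) (P : probability Omega R) (I : finType)
    (u : I -> {RV P >-> R}) : Prop :=
  forall (J : {set I}) (B : I -> set R),
    (forall j, j \in J -> measurable (B j)) ->
    P (\bigcap_(j in [set` J]) (u j @^-1` B j)) =
    (\prod_(j in J) P (u j @^-1` B j))%E.
Arguments mutually_independent {d Omega R} P {I} u.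

(* Equality of laws is only required on Borel sets: the library's measures are
   functions on all sets, unconstrained outside the sigma-algebra. *)
Definition has_law (d : measure_display) (Omega : measurableType d)
    (R : realType) (P : probability Omega R) (X : {RV P >-> R})
    (mu : {measure set (measurableTypeR R) -> \bar R}) : Prop :=
  forall A : set R, measurable A -> distribution P X A = mu A.
Arguments has_law {d Omega R} P X mu.

(* The default value of the iterated maximum is one of the operands, so this is
   the maximum over j of beta j * u j, also when these numbers are negative. *)
Definition resulting_probability (d : measure_display)
    (Omega : measurableType d) (R : realType) (P : probability Omega R)
    (n : nat) (u : 'I_n -> {RV P >-> R}) (beta : 'I_n -> R)
    (i : 'I_n) : \bar R :=
  P [set w | beta i * u i w =
             \big[Order.max/(beta i * u i w)]_(j < n) (beta j * u j w)].
Arguments resulting_probability {d Omega R} P {n} u beta i.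

(* The resulting probabilities depend only on the laws D, so they are required
   to be 1/n for every choice of the independent u j with law D j; such a choice
   always exists by [independent_realization] below. *)
Definition equalizing (R : realType) (n : nat)
    (D : 'I_n -> probability (measurableTypeR R) R) (beta : 'I_n -> R) : Prop :=
  forall (d : measure_display) (Omega : measurableType d)
    (P : probability Omega R) (u : 'I_n -> {RV P >-> R}),
    mutually_independent P u -> (forall j, has_law P (u j) (D j)) ->
    forall i, resulting_probability P u beta i = (n%:R^-1)%:E.

Section realization.
Variable R : realType.

Let product_realization (n : nat)
    (D : 'I_n -> probability (measurableTypeR R) R) :
  exists (d : measure_display) (Omega : measurableType d)
    (P : probability Omega R) (u : 'I_n -> Omega -> R),
    (forall j, measurable_fun setT (u j)) /\
    forall B : 'I_n -> set R, (forall j, measurable (B j)) ->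
      P (\bigcap_j (u j @^-1` B j)) = (\prod_(j < n) D j (B j))%E.
Proof.
elim: n D => [|n IHn] D.
  exists _, (measurableTypeR R), (dirac (0 : measurableTypeR R)).
  exists (fun _ _ => 0); split.
    by case.
  move=> B _; rewrite big_ord0 (_ : \bigcap_j _ = setT) ?probability_setT//.
  by apply/seteqP; split=> // x _ [].
have [d [T [P [u [umeas uB]]]]] := IHn (fun j => D (lift ord0 j)).
pose u' (i : 'I_n.+1) (w : measurableTypeR R * T) : R :=
  if unlift ord0 i is Some k then u k w.2 else w.1.
exists _, (measurableTypeR R * T)%type, (D ord0 \x P)%E, u'; split.
  move=> j; rewrite /u'; case: unliftP => [k _|_]; last exact: measurable_fst.
  exact: measurableT_comp (umeas k) measurable_snd.
move=> B mB.
have -> : \bigcap_j (u' j @^-1` B j) =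
    B ord0 `*` \bigcap_j (u j @^-1` B (lift ord0 j)).
  apply/seteqP; split=> [w Bw|w [w1 w2] j _].
    split; first by have := Bw ord0 I; rewrite /u'/= unlift_none.
    by move=> j _; have := Bw (lift ord0 j) I; rewrite /u'/= liftK.
  rewrite /u'/=; case: unliftP => [k ->|->] //; exact: w2.
have mC : measurable (\bigcap_j (u j @^-1` B (lift ord0 j))).
  apply: fin_bigcap_measurable => //= j _.
  by rewrite -[X in measurable X]setTI; exact: umeas.
rewrite big_ord_recl -(uB (fun j => B (lift ord0 j))); last first.
  by move=> j; exact: mB.
exact: (product_measure1E (D ord0) P (mB ord0) mC).
Qed.

Lemma independent_realization (n : nat)
    (D : 'I_n -> probability (measurableTypeR R) R) :
  exists (d : measure_display) (Omega : measurableType d)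
    (P : probability Omega R) (u : 'I_n -> {RV P >-> R}),
    mutually_independent P u /\ forall j, has_law P (u j) (D j).
Proof.
have [d [T [P [u [umeas uB]]]]] := product_realization D.
pose X j : {RV P >-> R} :=
  HB.pack (u j) (@isMeasurableFun.Build _ _ _ _ (u j) (umeas j)).
have XJ (J : {set 'I_n}) (B : 'I_n -> set R) :
    (forall j, j \in J -> measurable (B j)) ->
    P (\bigcap_(j in [set` J]) (X j @^-1` B j)) = (\prod_(j in J) D j (B j))%E.
  move=> mB; pose B' j := if j \in J then B j else setT.
  have mB' j : measurable (B' j).
    by rewrite /B'; case: ifPn => // /mB.
  have := uB B' mB'; rewrite (_ : \bigcap_j _ =
      \bigcap_(j in [set` J]) (X j @^-1` B j)); last first.
    apply/seteqP; split=> w Bw j.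
      by move=> /= jJ; have := Bw j I; rewrite /= /B' jJ.
    by move=> _ /=; rewrite /B'; case: ifPn => // jJ; exact: Bw.
  move=> ->; rewrite [RHS]big_mkcond; apply: eq_bigr => j _.
  by rewrite /B'; case: ifPn => // _; rewrite probability_setT.
have XD j A : measurable A -> P (X j @^-1` A) = D j A.
  move=> mA; have := XJ [set j]%SET (fun=> A) (fun _ _ => mA).
  rewrite big_set1 => <-; congr (P _).
  apply/seteqP; split=> w Aw; first by move=> k /=; rewrite inE => /eqP ->.
  by apply: Aw; rewrite /= inE.
exists d, T, P, X; split=> [J B mB|j A mA]; last exact: XD.
by rewrite XJ//; apply: eq_bigr => j jJ; rewrite XD//; exact: mB.
Qed.

End realization.

(* Main.v *)
(* Normalize beta_0 = 1. Raising beta_i raises p_i and lowers every other p_j, as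
   for prices of gross substitutes. Hence the coordinatewise supremum of all beta
   with p_i(beta) <= 1/n for every i <> 0 again satisfies these inequalities, and
   it satisfies them with equality: otherwise one coordinate could be increased a
   little. The remaining p_0 is 1/n because ties have probability 0, so that the
   p_i sum to 1. The supremum is finite because p_0 >= 1/n, whereas p_0 tends to 0
   when some beta_i tends to infinity. *)
Require Import Defs.
From HB Require Import structures.
From mathcomp Require Import all_boot all_order all_algebra.
From mathcomp Require Import all_classical all_reals all_analysis.
From mathcomp Require Import measurable_realfun lra.
Import Order.TTheory GRing.Theory Num.Theory.
Import numFieldNormedType.Exports.
Local Open Scope classical_set_scope.
Local Open Scope ring_scope.

(** * Equalization for abstract gross substitutes *)

Definition update {I : eqType} {T : Type} (b : I -> T) (i : I) (t : T) : I -> T :=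
  fun j => if j == i then t else b j.

Lemma update_same {I : eqType} {T : Type} (b : I -> T) i t : update b i t i = t.
Proof. by rewrite /update eqxx. Qed.

Lemma update_other {I : eqType} {T : Type} (b : I -> T) i t j :
  j != i -> update b i t j = b j.
Proof. by rewrite /update => /negbTE ->. Qed.

(* The third and fourth hypotheses are right and left continuity of p i in its own
   coordinate, reduced to what monotonicity does not already give. *)
Lemma gross_substitutes_equalize (R : realType) (n : nat)
    (p : 'I_n.+1 -> ('I_n.+1 -> R) -> R) :
  (forall i b b', b' i <= b i -> (forall j, j != i -> b j <= b' j) ->
    p i b' <= p i b) ->
  (forall b, (forall i, 0 < b i) -> \sum_i p i b = 1) ->
  (forall i b c, (forall j, 0 < b j) -> p i b < c ->
    exists2 t, b i < t & p i (update b i t) < c) ->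
  (forall i b c, (forall j, 0 < b j) -> c < p i b ->
    exists2 t, t < b i & c < p i (update b i t)) ->
  (forall i j c, i != j -> 0 < c -> exists2 M, 0 < M &
    forall b, (forall k, 0 < b k) -> M * b i <= b j -> p i b < c) ->
  exists2 b, (forall i, 0 < b i) & forall i, p i b = n.+1%:R^-1.
Proof.
move=> pmono psum pright pleft pdom; set c : R := n.+1%:R^-1.
have c0 : 0 < c by rewrite invr_gt0 ltr0n.
have sumc : \sum_(i < n.+1) c = 1.
  by rewrite sumr_const card_ord -mulr_natl divff// pnatr_eq0.
pose A := [set b : 'I_n.+1 -> R | [/\ forall i, 0 < b i, b ord0 = 1 &
  forall i, i != ord0 -> p i b <= c]].
(* [A] is nonempty: with [b i = (m i)^-1] one has [m i * b i = 1 = b ord0], so agent [ord0]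
   dominates every other agent enough to push its [p i] below [c]. *)
have [b0 Ab0] : A !=set0.
  have /choice[m mP] : forall i, exists m, 0 < m /\
      (i != ord0 -> forall b, (forall k, 0 < b k) ->
        m * b i <= b ord0 -> p i b < c).
    move=> i; have [->|i0] := eqVneq i ord0; first by exists 1; split.
    by have [M M0 MP] := pdom i ord0 c i0 c0; exists M; split.
  pose b i := if i == ord0 then 1 else (m i)^-1.
  have bpos i : 0 < b i.
    by rewrite /b; case: ifP => // _; rewrite invr_gt0; exact: (mP i).1.
  exists b; split => // i i0.
  apply/ltW/(mP i).2 => //; rewrite /b eqxx (negbTE i0) divff//.
  by rewrite gt_eqF//; exact: (mP i).1.
have ge_c b : A b -> c <= p ord0 b.
  move=> [bpos b01 bA]; have := psum b bpos.
  rewrite -[RHS]sumc !big_ord_recl => E.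
  have : \sum_(i < n) p (lift ord0 i) b <= \sum_(i < n) c.
    by apply: ler_sum => i _; exact: bA.
  by lra.
pose S i := [set b i | b in A].
have Sne i : S i !=set0 by exists (b0 i), b0.
have Sub i : has_ubound (S i).
  have [->|i0] := eqVneq i ord0.
    by exists 1 => _ [b [_ b01 _] <-]; rewrite b01.
  (* Since [b ord0 = 1], a coordinate [b i] above [M] would make [i] dominate [ord0] and force
     [p ord0 b < c], against [ge_c]. *)
  have [M M0 MP] := pdom ord0 i c (contra_neq esym i0) c0.
  exists M => _ [b Ab <-]; rewrite leNgt; apply/negP => Mb.
  have [bpos b01 _] := Ab.
  have := MP b bpos; rewrite b01 mulr1 => /(_ (ltW Mb)).
  by rewrite ltNge ge_c.
pose bs i := sup (S i).
have bs_ub b i : A b -> b i <= bs i.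
  by move=> Ab; apply: ub_le_sup => //; exists b.
have bs_pos i : 0 < bs i.
  by apply: lt_le_trans (bs_ub b0 i Ab0); case: Ab0.
have bs0 : bs ord0 = 1.
  rewrite /bs (_ : S ord0 = [set 1]) ?sup1//; apply/seteqP; split.
    by move=> _ [b [_ b01 _] <-].
  by move=> _ ->; exists b0 => //; case: Ab0.
have bsA i : i != ord0 -> p i bs <= c.
  (* Left continuity leaves an excess at some [t < bs i], and some [b] in [A] has [b i > t]. Passing
     from [update bs i t] to [b] raises coordinate [i] and lowers the others, so [p i b] exceeds [c]
     too. *)
  move=> i0; rewrite leNgt; apply/negP => /(pleft _ _ _ bs_pos)[t tlt ct].
  have [_ [b Ab <-] tb] := sup_gt (Sne i) tlt.
  have [_ _ /(_ i i0)] := Ab; rewrite leNgt => /negP; apply.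
  apply: lt_le_trans ct _; apply: pmono => [|j ji].
    by rewrite update_same ltW.
  by rewrite update_other// bs_ub.
have bsE i : i != ord0 -> p i bs = c.
  move=> i0; apply/eqP; rewrite eq_le bsA//= leNgt; apply/negP => plt.
  have [t tgt ct] := pright _ _ _ bs_pos plt.
  (* The raised vector stays in [A], as raising coordinate [i] alone can only lower the other [p j];
     its coordinate [t > bs i] then contradicts the supremum. *)
  suff At : A (update bs i t) by have := bs_ub _ i At; rewrite update_same leNgt tgt.
  split=> [j||j j0].
  - rewrite /update; case: ifP => // _; exact: lt_trans tgt.
  - by rewrite update_other// eq_sym.
  - have [->|ji] := eqVneq j i; first exact: ltW.
    apply: le_trans (bsA j j0); apply: pmono => [|k kj].
      by rewrite update_other.
    by rewrite /update; case: eqP => // ->; exact: ltW.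
exists bs => // i; have [->|i0] := eqVneq i ord0; last exact: bsE.
have := psum bs bs_pos; rewrite -[RHS]sumc !big_ord_recl.
under eq_bigr do rewrite bsE//.
by move=> /addIr.
Qed.

(** * Null sets and continuity of measures along monotone sequences *)

Section measure_facts.
Context {d : measure_display} {T : measurableType d} {R : realType}.

Lemma le_measure_setU_null (mu : {measure set T -> \bar R}) (A B N : set T) :
  measurable A -> measurable B -> measurable N -> mu N = 0%E ->
  A `<=` B `|` N -> (mu A <= mu B)%E.
Proof.
move=> mA mB mN N0 AB; rewrite -(measureU0 mB mN N0).
by apply: le_measure; rewrite ?inE//; exact: measurableU.
Qed.

(** Continuity from above, in the form that turns a strict bound in the limit into one at a finite
    stage. Asking only for an inclusion in [B] leaves a single pointwise implication to check in
    each application. *)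
Lemma probability_bigcap_lt (P : probability T R) (A : nat -> set T) (B : set T)
    (c : \bar R) :
  (forall k, measurable (A k)) -> measurable B ->
  (forall k l, (k <= l)%N -> A l `<=` A k) -> \bigcap_k A k `<=` B ->
  (P B < c)%E -> exists k, (P (A k) < c)%E.
Proof.
move=> mA mB Adec AB Bc.
have mI : measurable (\bigcap_k A k) by exact: bigcap_measurable.
have Ic : (P (\bigcap_k A k) < c)%E.
  by apply: le_lt_trans Bc; apply: le_measure; rewrite ?inE.
have Pcv : (P \o A) x @[x --> \oo] --> P (\bigcap_k A k).
  apply: nonincreasing_cvg_mu => //.
    by rewrite -ge0_fin_numE// fin_num_measure.
  by move=> k l kl; apply/subsetPset; exact: Adec.
have [k _ /(_ k (leqnn k))] :=
  Pcv _ (open_nbhs_nbhs (conj (open_ereal_lt_ereal (x := c)) Ic)).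
by exists k.
Qed.

Lemma probability_bigcup_gt (P : probability T R) (A : nat -> set T) (B : set T)
    (c : \bar R) :
  (forall k, measurable (A k)) -> measurable B ->
  (forall k l, (k <= l)%N -> A k `<=` A l) -> B `<=` \bigcup_k A k ->
  (c < P B)%E -> exists k, (c < P (A k))%E.
Proof.
move=> mA mB Ainc AB Bc.
have mU : measurable (\bigcup_k A k) by exact: bigcup_measurable.
have cU : (c < P (\bigcup_k A k))%E.
  by apply: lt_le_trans Bc _; apply: le_measure; rewrite ?inE.
have Pcv : (P \o A) x @[x --> \oo] --> P (\bigcup_k A k).
  apply: nondecreasing_cvg_mu => //.
  by move=> k l kl; apply/subsetPset; exact: Ainc.
have [k _ /(_ k (leqnn k))] :=
  Pcv _ (open_nbhs_nbhs (conj (open_ereal_gt_ereal (x := c)) cU)).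
by exists k.
Qed.

Lemma measure_bigcup_fin_null (mu : {measure set T -> \bar R}) (I : finType)
    (F : I -> set T) :
  (forall i, measurable (F i)) -> (forall i, mu (F i) = 0%E) ->
  mu (\bigcup_i F i) = 0%E.
Proof.
(* [G] lists the family as a sequence padded with empty sets, so that countable subadditivity
   applies. *)
move=> mF F0; pose G k :=
  if insub k is Some j then F (enum_val (j : 'I_#|I|)) else set0.
have mG k : measurable (G k) by rewrite /G; case: insub.
apply: measure_negligible; first exact: fin_bigcup_measurable.
apply: (@negligibleS _ _ _ _ (\bigcup_k G k)).
  move=> w [i _ Fi]; exists (enum_rank i) => //.
  by rewrite /G valK enum_rankK.
apply: negligible_bigcup => k.
apply/(negligibleP mu (mG k)).
by rewrite /G; case: insub => [j|]; [exact: F0|exact: measure0].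
Qed.

Lemma measurable_mul_le (f g : T -> R) (a b : R) :
  measurable_fun setT f -> measurable_fun setT g ->
  measurable [set w | a * f w <= b * g w].
Proof.
move=> mf mg; rewrite -[X in measurable X]setTI.
by apply: measurable_fun_le => //; exact: measurable_funM.
Qed.

End measure_facts.

(** * Consequences of independence: null ties and uniqueness of the joint law *)

(* Two coordinates of an independent family have a product law, under which a
   line meets every vertical section in a single point. *)
Lemma independent_ties_null {d : measure_display} {Omega : measurableType d}
    {R : realType} (P : probability Omega R) (I : finType)
    (u : I -> {RV P >-> R}) (D : I -> probability (measurableTypeR R) R)
    (i j : I) (a b : R) :
  mutually_independent P u -> (forall k, has_law P (u k) (D k)) ->
  nonatomic (D j) -> i != j -> b != 0 ->
  P [set w | a * u i w = b * u j w] = 0%E.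
Proof.
move=> uind ulaw Dj ij b0.
have mui k : measurable_fun setT (u k) by exact: (measurable_funPT (u k)).
pose f w := (u i w : measurableTypeR R, u j w : measurableTypeR R).
have mf : measurable_fun setT f by apply: measurable_fun_pair; exact: mui.
pose X : {mfun Omega >-> (measurableTypeR R * measurableTypeR R)%type} :=
  HB.pack f (@isMeasurableFun.Build _ _ _ _ f mf).
pose L : set (measurableTypeR R * measurableTypeR R) :=
  [set x | a * x.1 = b * x.2].
have mL : measurable L.
  rewrite (_ : L = [set x | a * x.1 <= b * x.2] `&` [set x | b * x.2 <= a * x.1]).
    by apply: measurableI; apply: measurable_mul_le;
      [exact: measurable_fst|exact: measurable_snd|
       exact: measurable_snd|exact: measurable_fst].
  apply/seteqP; split=> x; rewrite /L/=; first by move=> ->.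
  by move=> le12; apply/le_anti/andP.
rewrite -[LHS]/(distribution P X L).
have <- := @product_measure_unique _ _ _ _ _ (D i) (D j) (distribution P X) _ L mL.
  apply: integral0_eq => x _ /=.
  rewrite (_ : xsection L x = [set b^-1 * (a * x)]) ?Dj//.
  apply/seteqP; split=> y; rewrite /xsection/= inE /L/=.
    by move=> ->; rewrite mulKf.
  by move=> ->; rewrite mulVKf.
(* It remains to compare the two laws on rectangles. This is independence for the pair [i], [j],
   where [i != j] makes [C j] equal to [B]. *)
move=> A B mA mB; pose C k := if k == i then A else B.
have mC k : measurable (C k) by rewrite /C; case: ifP.
have := uind [set i; j]%SET C (fun k _ => mC k).
rewrite big_setU1 ?inE//= big_set1 /C eqxx eq_sym (negbTE ij).
rewrite -(ulaw i A mA) -(ulaw j B mB) => <-.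
congr (P _); apply/seteqP; split=> w.
  move=> [Aw Bw] k /=; rewrite !inE => /orP[]/eqP ->.
    by rewrite eqxx.
  by rewrite eq_sym (negbTE ij).
move=> Cw; split.
  by have := Cw i; rewrite /= !inE !eqxx => /(_ isT).
by have := Cw j; rewrite /= !inE eqxx orbT eq_sym (negbTE ij) => /(_ isT).
Qed.

Definition measurable_boxes (R : realType) (I : Type) : set (set (I -> R)) :=
  [set X | exists2 B : I -> set R, (forall j, measurable (B j)) &
     X = [set x | forall j, B j (x j)]].
Arguments measurable_boxes : clear implicits.

(* Measurable boxes form a pi-system, so a joint law is determined by its
   marginals under independence. *)
Lemma independent_joint_law (R : realType) (I : finType)
    (D : I -> probability (measurableTypeR R) R)
    (d d' : measure_display) (Omega : measurableType d)
    (Omega' : measurableType d') (P : probability Omega R)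
    (P' : probability Omega' R) (u : I -> {RV P >-> R}) (u' : I -> {RV P' >-> R})
    (X : set (I -> R)) :
  mutually_independent P u -> (forall j, has_law P (u j) (D j)) ->
  mutually_independent P' u' -> (forall j, has_law P' (u' j) (D j)) ->
  <<s measurable_boxes R I>> X ->
  P [set w | X (fun j => u j w)] = P' [set w | X (fun j => u' j w)].
Proof.
(* [S] is [I -> R] with the product sigma-algebra; the whole family becomes one random element of
   [S], whose law can be compared across sample spaces. *)
pose S := g_sigma_algebraType (measurable_boxes R I).
have mfun e (W : measurableType e) (Q : probability W R) (v : I -> {RV Q >-> R}) :
    measurable_fun setT ((fun w j => v j w) : W -> S).
  apply: (@measurability _ _ W S setT _ (measurable_boxes R I)) => //.
  move=> _ [_ [B mB ->] <-]; rewrite setTI.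
  rewrite (_ : _ @^-1` _ = \bigcap_j (v j @^-1` B j)).
    apply: fin_bigcap_measurable => // j _.
    by rewrite -[X in measurable X]setTI; exact: (measurable_funPT (v j)).
  by apply/seteqP; split=> w Bw j //=; exact: (Bw j).
pose joint e (W : measurableType e) (Q : probability W R) (v : I -> {RV Q >-> R})
  : {mfun W >-> S} := HB.pack ((fun w j => v j w) : W -> S)
    (@isMeasurableFun.Build _ _ _ _ _ (mfun e W Q v)).
have box e (W : measurableType e) (Q : probability W R) (v : I -> {RV Q >-> R})
    (B : I -> set R) : mutually_independent Q v ->
    (forall j, has_law Q (v j) (D j)) -> (forall j, measurable (B j)) ->
    distribution Q (joint e W Q v) [set x | forall j, B j (x j)] =
    (\prod_j D j (B j))%E.
  move=> vind vlaw mB.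
  have := vind [set: I]%SET B (fun j _ => mB j).
  rewrite (_ : \bigcap_(j in _) _ = [set w | forall j, B j (v j w)]).
    move=> E; apply: (etrans E).
    by apply: eq_big => [j|j _]; [rewrite inE|exact: vlaw].
  apply/seteqP; split=> w Bw j; last by move=> _; exact: Bw.
  by apply: Bw; rewrite /= inE.
move=> uind ulaw uind' ulaw' sX.
apply: (@measure_unique _ R S (measurable_boxes R I) (fun=> setT) erefl _ _ _
  (distribution P (joint _ _ P u)) (distribution P' (joint _ _ P' u'))) => //.
- move=> _ _ [A mA ->] [B mB ->]; exists (fun j => A j `&` B j).
    by move=> j; exact: measurableI.
  apply/seteqP; split=> [x [Ax Bx] j|x ABx]; first by split; [exact: Ax|exact: Bx].
  by split=> j; have [] := ABx j.
- move=> _; exists (fun=> setT) => //.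
  by apply/seteqP; split=> x.
- by apply/seteqP; split=> // x _; exists 0%N.
- move=> _ [B mB ->].
  exact: etrans (box _ _ _ _ _ uind ulaw mB)
    (esym (box _ _ _ _ _ uind' ulaw' mB)).
- move=> _; apply: le_lt_trans (ltry 1); exact: probability_le1.
Qed.

(** * Pointwise relations between winning events *)

Section winning_events.
Context {Omega : Type} {R : realType}.
Context {n : nat} (u : 'I_n -> Omega -> R).
Implicit Types (b : 'I_n -> R) (i j : 'I_n).

Definition best b i : set Omega := [set w | forall j, b j * u j w <= b i * u i w].

Definition positive : set Omega := [set w | forall j, 0 < u j w].

(** The strict version serves two purposes: these events are disjoint for distinct agents, and a
    strict win survives a small decrease of [b i]. *)
Definition best_strictly b i : set Omega :=
  [set w | forall j, j != i -> b j * u j w < b i * u i w].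

Lemma best_update_increasing b i s t :
  s <= t ->
  positive `&` best (update b i s) i `<=` best (update b i t) i.
Proof.
move=> st w [pos bw] j; have [->//|ji] := eqVneq j i.
have := bw j; rewrite !update_same !update_other// => /le_trans; apply.
by rewrite ler_wpM2r// ltW.
Qed.

(** If some [j] beat [i] strictly at [b], then [b i] would lie below [b j * u j w / u i w], and a
    small enough increase of [b i] would still leave [i] behind. *)
Lemma bigcap_best_update b i :
  \bigcap_k (positive `&` best (update b i (b i + k.+1%:R^-1)) i) `<=`
  positive `&` best b i.
Proof.
move=> w bw; have [pos _] := bw 0%N I; split=> // j.
have [->//|ji] := eqVneq j i.
rewrite leNgt -ltr_pdivlMr//; apply/negP => /ltr_add_invr[k].
have [_ /(_ j)] := bw k I.
by rewrite update_same update_other// -ler_pdivrMr// leNgt => /negP.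
Qed.

Lemma best_strictly_bigcup_update b i :
  positive `&` best_strictly b i `<=`
  \bigcup_k (positive `&` best (update b i (b i - k.+1%:R^-1)) i).
Proof.
move=> w [pos bw].
have /choice[k kP] : forall j, exists k, j != i ->
    b j * u j w / u i w + k.+1%:R^-1 < b i.
  move=> j; have [->|ji] := eqVneq j i; first by exists 0%N.
  have := bw j ji; rewrite -ltr_pdivrMr// => /ltr_add_invr[k kP].
  by exists k.
(* Each rival [j] tolerates a decrease by [(k j).+1%:R^-1]; the largest of the finitely many [k j]
   gives a decrease tolerated by all. *)
exists (\max_j k j)%N => //; split=> // j.
have [->//|ji] := eqVneq j i; rewrite update_same update_other// -ler_pdivrMr//.
have := kP j ji; rewrite -ltrBrDr => /ltW/le_trans; apply.
by rewrite lerD2l lerN2 lef_pV2 ?posrE ?ltr0n// ler_nat ltnS leq_bigmax.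
Qed.

(** By the Archimedean property, the positive ratio [u j w / u i w] cannot stay below every
    [k.+1%:R^-1]. *)
Lemma bigcap_dominated i j :
  \bigcap_k (positive `&` [set w | k.+1%:R * u j w <= 1 * u i w]) `<=` set0.
Proof.
move=> w bw; have [pos _] := bw 0%N I.
have [k] := ltr_add_invr (divr_gt0 (pos j) (pos i)); rewrite add0r.
have [_ /=] := bw k I; rewrite mul1r => le1.
rewrite ltNge => /negP; apply.
by rewrite ler_pdivrMr// mulrC ler_pdivlMr// mulrC.
Qed.

End winning_events.

(** * Measurability of the winning events *)

Section measurable_winning_events.
Context {d : measure_display} {Omega : measurableType d} {R : realType}.
Context {n : nat} (u : 'I_n -> Omega -> R).
Implicit Types (b : 'I_n -> R) (i j : 'I_n).
Hypothesis u_meas : forall j, measurable_fun setT (u j).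

Lemma measurable_best b i : measurable (best u b i).
Proof.
rewrite (_ : best u b i = \bigcap_j [set w | b j * u j w <= b i * u i w]).
  by apply: fin_bigcap_measurable => // j _; exact: measurable_mul_le.
by apply/seteqP; split=> w bw j; [move=> _|]; exact: bw.
Qed.

Lemma measurable_nonpositive j : measurable [set w | u j w <= 0].
Proof.
rewrite (_ : [set w | _] = [set w | 1 * u j w <= 0 * u j w]).
  exact: measurable_mul_le.
by apply/seteqP; split=> w /=; rewrite mul1r mul0r.
Qed.

Lemma measurable_positive : measurable (positive u).
Proof.
rewrite (_ : positive u = \bigcap_j ~` [set w | u j w <= 0]).
  apply: fin_bigcap_measurable => // j _.
  exact/measurableC/measurable_nonpositive.
apply/seteqP; split=> w bw j.
  by move=> _; apply/negP; rewrite -ltNge; exact: bw.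
by have /negP := bw j I; rewrite -ltNge.
Qed.

Lemma measurable_best_strictly b i : measurable (best_strictly u b i).
Proof.
rewrite (_ : best_strictly u b i =
    \bigcap_(j in [set` predC1 i]) ~` [set w | b i * u i w <= b j * u j w]).
  apply: fin_bigcap_measurable => [|j _]; first exact: finite_finset.
  exact/measurableC/measurable_mul_le.
apply/seteqP; split=> w bw j.
  by move=> ji; apply/negP; rewrite -ltNge; exact: bw.
by move=> ji; have /negP := bw j ji; rewrite -ltNge.
Qed.

Lemma measurable_tie (a c : R) i j : measurable [set w | a * u i w = c * u j w].
Proof.
rewrite (_ : [set w | _] = [set w | a * u i w <= c * u j w] `&`
    [set w | c * u j w <= a * u i w]).
  by apply: measurableI; exact: measurable_mul_le.
apply/seteqP; split=> w /=; first by move=> ->.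
by move=> le12; apply/le_anti/andP.
Qed.

End measurable_winning_events.

(** * Winning probabilities as gross substitutes *)

Section resulting_probabilities.
Context {d : measure_display} {Omega : measurableType d} {R : realType}.
Context (P : probability Omega R) {n : nat} (u : 'I_n.+1 -> {RV P >-> R}).
Context (D : 'I_n.+1 -> probability (measurableTypeR R) R).
Hypothesis D_unit : forall j, D j `[(0 : R), (1 : R)]%classic = 1%E.
Hypothesis D_nonatomic : forall j, nonatomic (D j).
Hypothesis u_indep : mutually_independent P u.
Hypothesis u_law : forall j, has_law P (u j) (D j).
Implicit Types (b : 'I_n.+1 -> R) (i j : 'I_n.+1).

Let u_meas j : measurable_fun setT (u j).
Proof. exact: (measurable_funPT (u j)). Qed.

(** A nonpositive value is either [0], which has no mass because [D j] is nonatomic, or lies outside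
    the unit interval, whose complement is null. *)
Lemma nonpositive_null j : P [set w | u j w <= 0] = 0%E.
Proof.
have mN : measurable (`]-oo, (0 : R)]%classic : set (measurableTypeR R)).
  exact: measurable_itv.
have mU : measurable (`[(0 : R), (1 : R)]%classic : set (measurableTypeR R)).
  exact: measurable_itv.
have -> : [set w | u j w <= 0] = u j @^-1` `]-oo, (0 : R)]%classic.
  by apply/seteqP; split=> w /=; rewrite in_itv.
rewrite -[LHS]/(distribution P (u j) _) (u_law j _ mN).
have mC : measurable (~` `[(0 : R), (1 : R)]%classic : set (measurableTypeR R)).
  exact: measurableC.
have m0 : measurable ([set (0 : R)] : set (measurableTypeR R)).
  exact: measurable_set1.
have C0 : D j (~` `[(0 : R), (1 : R)]%classic) = 0%E.
  by rewrite probability_setC// D_unit subee.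
apply: (subset_measure0 mN (measurableU _ _ m0 mC)) => [x|].
  rewrite /= !in_itv/= => x0; have [->|xn0] := eqVneq x 0; first by left.
  by right=> /andP[x0' _]; move: xn0; rewrite eq_le x0 x0'.
exact: etrans (measureU0 m0 mC C0) (D_nonatomic j 0).
Qed.

(** Off this set all values are positive and there are no ties. Equal indices contribute [set0],
    since an agent's tie with itself would be the whole space. *)
Definition exceptional b : set Omega :=
  (\bigcup_j [set w | u j w <= 0]) `|`
  \bigcup_(ij : 'I_n.+1 * 'I_n.+1)
    (if ij.1 == ij.2 then set0 else [set w | b ij.1 * u ij.1 w = b ij.2 * u ij.2 w]).

Lemma measurable_exceptional b : measurable (exceptional b).
Proof.
apply: measurableU.
  apply: fin_bigcup_measurable => // j _.
  exact: (measurable_nonpositive _ u_meas).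
apply: fin_bigcup_measurable => // -[i j] _ /=.
by case: ifP => // _; exact: (measurable_tie _ u_meas).
Qed.

Lemma exceptional_null b : (forall i, 0 < b i) -> P (exceptional b) = 0%E.
Proof.
move=> b0; rewrite measureU0.
- apply: measure_bigcup_fin_null => j.
    exact: (measurable_nonpositive _ u_meas).
  exact: nonpositive_null.
- apply: fin_bigcup_measurable => // j _.
  exact: (measurable_nonpositive _ u_meas).
- apply: fin_bigcup_measurable => // -[i j] _ /=.
  by case: ifP => // _; exact: (measurable_tie _ u_meas).
- apply: measure_bigcup_fin_null => -[i j] /=; case: ifPn => // ij.
  + exact: (measurable_tie _ u_meas).
  + by apply: (independent_ties_null _ _ _ D) => //; rewrite gt_eqF.
Qed.

Lemma not_exceptional b w : ~ exceptional b w ->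
  (forall j, 0 < u j w) /\ (forall i j, i != j -> b i * u i w != b j * u j w).
Proof.
move=> Nw; split=> [j|i j ij].
  by rewrite ltNge; apply/negP => ujw; apply: Nw; left; exists j.
apply/eqP => bij; apply: Nw; right; exists (i, j) => //=.
by rewrite (negbTE ij).
Qed.

(* Restricting to positive values makes this monotone in b without any condition
   on the sign of b. *)
Definition win_prob i b : R := fine (P (positive u `&` best u b i)).

Let m_pos_best b i : measurable (positive u `&` best u b i).
Proof.
apply: measurableI; first exact: (measurable_positive _ u_meas).
exact: (measurable_best _ u_meas).
Qed.

Let m_pos_strict b i : measurable (positive u `&` best_strictly u b i).
Proof.
apply: measurableI; first exact: (measurable_positive _ u_meas).
exact: (measurable_best_strictly _ u_meas).
Qed.

Lemma win_probE i b : (win_prob i b)%:E = P (positive u `&` best u b i).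
Proof. by rewrite /win_prob fineK// fin_num_measure. Qed.

Lemma best_prob b i : (forall i, 0 < b i) -> P (best u b i) = (win_prob i b)%:E.
Proof.
move=> b0; rewrite win_probE; apply/eqP; rewrite eq_le; apply/andP; split.
  apply: (le_measure_setU_null _ _ _ (exceptional b)) => //.
  - exact: (measurable_best _ u_meas).
  - exact: measurable_exceptional.
  - exact: exceptional_null.
  - move=> w bw; have [Ew|/not_exceptional[pos _]] := pselect (exceptional b w).
      by right.
    by left; split.
by apply: le_measure; rewrite ?inE//; exact: (measurable_best _ u_meas).
Qed.

(** Weak and strict wins differ only by ties, hence within the null set [exceptional b]. *)
Lemma best_strictly_prob b i : (forall i, 0 < b i) ->
  P (positive u `&` best_strictly u b i) = (win_prob i b)%:E.
Proof.
move=> b0; rewrite win_probE; apply/eqP; rewrite eq_le; apply/andP; split.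
  apply: le_measure; rewrite ?inE// => w [pos bw]; split=> // j.
  by have [->//|ji] := eqVneq j i; exact/ltW/bw.
apply: (le_measure_setU_null _ _ _ (exceptional b)) => //.
- exact: measurable_exceptional.
- exact: exceptional_null.
- move=> w [pos bw]; have [Ew|/not_exceptional[_ tie]] := pselect (exceptional b w).
    by right.
  by left; split=> // j ji; rewrite lt_neqAle tie//=; exact: bw.
Qed.

(** Strict winning events are pairwise disjoint and cover the complement of [exceptional b], where
    the maximizer is unique. *)
Lemma win_prob_sum b : (forall i, 0 < b i) -> \sum_i win_prob i b = 1.
Proof.
move=> b0; apply: EFin_inj; rewrite -sumEFin.
under eq_bigr do rewrite -best_strictly_prob//.
rewrite -measure_semi_additive_ord//; last 2 first.
- apply/trivIsetP => i j _ _ ij; apply/seteqP; split=> // w [[_ bi] [_ bj]].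
  have ji : j != i by rewrite eq_sym.
  by have := lt_trans (bi j ji) (bj i ij); rewrite ltxx.
- exact: bigsetU_measurable.
have mU : measurable
    (\big[setU/set0]_(i < n.+1) (positive u `&` best_strictly u b i)).
  exact: bigsetU_measurable.
apply/eqP; rewrite eq_le probability_le1//= -(probability_setT P).
apply: (le_measure_setU_null _ _ _ (exceptional b)) => //.
- exact: measurable_exceptional.
- exact: exceptional_null.
- move=> w _; have [Ew|/not_exceptional[pos tie]] := pselect (exceptional b w).
    by right.
  left; rewrite -bigcup_seq.
  case: (arg_maxP (fun i => b i * u i w) (i0 := ord0) (P := xpredT) isT) => i _ imax.
  exists i; first by rewrite /= mem_index_enum.
  by split=> // j ji; rewrite lt_neqAle tie//=; exact: imax.
Qed.

Lemma win_prob_mono i b b' : b' i <= b i ->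
  (forall j, j != i -> b j <= b' j) -> win_prob i b' <= win_prob i b.
Proof.
move=> bi bj; rewrite -lee_fin !win_probE.
apply: le_measure; rewrite ?inE// => w [pos bw]; split=> // j.
have [->//|ji] := eqVneq j i.
have h1 : b j * u j w <= b' j * u j w by rewrite ler_wpM2r ?bj// ltW.
have h2 : b' i * u i w <= b i * u i w by rewrite ler_wpM2r// ltW.
exact: le_trans h1 (le_trans (bw j) h2).
Qed.

Lemma win_prob_right i b c : win_prob i b < c ->
  exists2 t, b i < t & win_prob i (update b i t) < c.
Proof.
rewrite -lte_fin win_probE => bc.
pose A k := positive u `&` best u (update b i (b i + k.+1%:R^-1)) i.
have Adec k l : (k <= l)%N -> A l `<=` A k.
  move=> kl w [pos bw]; split=> //; apply: best_update_increasing (conj pos bw).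
  by rewrite lerD2l lef_pV2 ?posrE ?ltr0n// ler_nat ltnS.
have [k ck] := probability_bigcap_lt P A _ _ (fun k => m_pos_best _ _)
  (m_pos_best _ _) Adec (bigcap_best_update u b i) bc.
exists (b i + k.+1%:R^-1); first by rewrite ltrDl invr_gt0.
by rewrite -lte_fin win_probE.
Qed.

(** Weak wins need not persist when [b i] decreases, so the argument passes to the strict event of
    equal probability and uses continuity from below. *)
Lemma win_prob_left i b c : (forall j, 0 < b j) -> c < win_prob i b ->
  exists2 t, t < b i & c < win_prob i (update b i t).
Proof.
move=> b0; rewrite -lte_fin -best_strictly_prob// => bc.
pose A k := positive u `&` best u (update b i (b i - k.+1%:R^-1)) i.
have Ainc k l : (k <= l)%N -> A k `<=` A l.
  move=> kl w [pos bw]; split=> //; apply: best_update_increasing (conj pos bw).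
  by rewrite lerD2l lerN2 lef_pV2 ?posrE ?ltr0n// ler_nat ltnS.
have [k ck] := probability_bigcup_gt P A _ _ (fun k => m_pos_best _ _)
  (m_pos_strict _ _) Ainc (best_strictly_bigcup_update u b i) bc.
exists (b i - k.+1%:R^-1); first by rewrite ltrBlDr ltrDl invr_gt0.
by rewrite -lte_fin win_probE.
Qed.

Lemma win_prob_dominated i j c : i != j -> 0 < c -> exists2 M, 0 < M &
  forall b, (forall k, 0 < b k) -> M * b i <= b j -> win_prob i b < c.
Proof.
move=> ij c0.
pose A k := positive u `&` [set w | k.+1%:R * u j w <= 1 * u i w].
have mA k : measurable (A k).
  apply: measurableI; first exact: (measurable_positive _ u_meas).
  exact: measurable_mul_le.
have Adec k l : (k <= l)%N -> A l `<=` A k.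
  move=> kl w [pos /= bw]; split=> //=; apply: le_trans bw.
  by rewrite ler_wpM2r ?ler_nat// ltW.
have c0' : (P set0 < c%:E)%E by rewrite measure0 lte_fin.
have [k ck] := probability_bigcap_lt P A _ _ mA measurable0 Adec
  (bigcap_dominated u i j) c0'.
(* The event [A k] does not mention [b], so the constant is uniform: [k.+1%:R * b i <= b j] and a
   win of [i] give [k.+1%:R * u j w <= u i w] after cancelling [b i]. *)
exists k.+1%:R => // b b0 Mb; rewrite -lte_fin win_probE.
apply: le_lt_trans ck; apply: le_measure; rewrite ?inE// => w [pos bw].
split=> //=; rewrite mul1r -(ler_pM2l (b0 i)) mulrA [b i * _]mulrC.
by apply: le_trans (bw j); rewrite ler_wpM2r// ltW.
Qed.

End resulting_probabilities.

(** * Transfer to arbitrary realizations and conclusion *)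

Lemma resulting_probabilityE (d : measure_display) (Omega : measurableType d)
    (R : realType) (P : probability Omega R) (n : nat) (u : 'I_n -> {RV P >-> R})
    (b : 'I_n -> R) (i : 'I_n) :
  resulting_probability P u b i = P (best u b i).
Proof.
congr (P _); apply/seteqP; split=> w /=.
  by move=> bE j; rewrite bE; exact: le_bigmax.
move=> bw; apply/le_anti/andP; split; first exact: (le_bigmax _ _ i).
by apply: bigmax_le => // j _; exact: bw.
Qed.

(** This is [measurable_best] on the canonical space ['I_n -> R], with the coordinate projections as
    values; the preimage of a Borel set under a projection is a box. *)
Lemma sigma_boxes_best (R : realType) (n : nat) (b : 'I_n -> R) (i : 'I_n) :
  <<s measurable_boxes R 'I_n>> (best (fun j x => x j) b i).
Proof.
pose S := g_sigma_algebraType (measurable_boxes R 'I_n).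
suff : @measurable _ S (best (fun j (x : S) => x j) b i) by [].
apply: measurable_best => j _ B mB; rewrite setTI.
apply: sub_sigma_algebra; exists (fun k => if k == j then B else setT).
  by move=> k; case: ifP.
apply/seteqP; split=> x /=; first by move=> Bx k; case: eqP => // ->.
by move=> /(_ j); rewrite eqxx.
Qed.

Theorem theorem4 (R : realType) (n : nat)
  (D : 'I_n -> probability (measurableTypeR R) R)
  (D_unit_interval : forall j, D j `[(0 : R), (1 : R)]%classic = 1%E)
  (D_nonatomic : forall j, nonatomic (D j)) :
  exists beta : 'I_n -> R, (forall i, 0 < beta i) /\ equalizing D beta.
Proof.
case: n D D_unit_interval D_nonatomic => [|n] D D_unit D_nonatomic.
  (* Without agents there is no [i] to check. *)
  by exists (fun=> 1); split=> // d Omega P u _ _ [].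
(* The multipliers are found on one fixed realization; equality of joint laws then carries the
   winning probabilities over to every other. *)
have [d [W [P [u [u_indep u_law]]]]] := independent_realization D.
have [b b0 bE] : exists2 b, (forall i, 0 < b i) &
    forall i, win_prob P u i b = n.+1%:R^-1.
  apply: gross_substitutes_equalize.
  - exact: win_prob_mono.
  - exact: win_prob_sum u_law.
  - by move=> i b c _; exact: win_prob_right.
  - by move=> i b c; exact: win_prob_left u_law _ _ _.
  - exact: win_prob_dominated.
exists b; split; first by [].
move=> d' Omega' P' v v_indep v_law i.
rewrite resulting_probabilityE -(bE i) -(best_prob P u D)//.
exact: (independent_joint_law _ _ D _ _ _ _ P' P v u _ v_indep v_law u_indep u_law
  (sigma_boxes_best R n.+1 b i)).
Qed.
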